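(* For $s\in\mathbb{C}$ and $n\in\mathbb{Z}_{\ge0}$, the power series expansions at $t=0$ of the functions $u_{[s;n]}(t)$ and $v_{[s;n]}(t)$ are $$u_{[s;n]}(t)=\sum_{k=0}^\infty P_k(s;n)\frac{t^{2k}}{(2k)!}\qquad\text{and}\qquad v_{[s;n]}(t)=\sum_{k=0}^\infty Q_k(s;n)\frac{t^{2k+1}}{(2k+1)!}.$$
   Context: $Hl(a,q;\alpha,\beta,\gamma,\delta;z)$ denotes the local Heun function, i.e. the power series solution at $z=0$ with constant term $1$ of Heun's equation $$f''(z)+\left(\frac\gamma z+\frac\delta{z-1}+\frac{\varepsilon}{z-a}\right)f'(z)+\frac{\alpha\beta z-q}{z(z-1)(z-a)}f(z)=0,\qquad \gamma+\delta+\varepsilon=\alpha+\beta+1,$$ and $$u_{[s;n]}(t)=Hl\left(-1,-\tfrac{ns}4;-\tfrac n2,-\tfrac{n-1}2,\tfrac12,\tfrac{1-n-s}2;t^2\right),$$ $$v_{[s;n]}(t)=t\,Hl\left(-1,-\tfrac{(n-2)s}4;-\tfrac{n-1}2,-\tfrac{n-2}2,\tfrac32,\tfrac{1-n-s}2;t^2\right).$$ Put $a(x)=2x(2x-1)$ and $b(x)=2x(2x+1)$. $P_0(x;y)=Q_0(x;y)=1$. For $k\ge1$, $P_k(x;y)$ is the determinant of the $k\times k$ tridiagonal matrix with diagonal entries $(y-4(i-1))x$ in position $(i,i)$ $(1\le i\le k)$, entries $a(i)$ in position $(i,i+1)$, and entries $-a\left(\frac{y-2i+2}{2}\right)$ in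 position $(i+1,i)$ $(1\le i\le k-1)$. For $k\ge1$, $Q_k(x;y)$ is the determinant of the $k\times k$ tridiagonal matrix with diagonal entries $(y-2-4(i-1))x$ in position $(i,i)$ $(1\le i\le k)$, entries $b(i)$ in position $(i,i+1)$, and entries $-b\left(\frac{y-2i}{2}\right)$ in position $(i+1,i)$ $(1\le i\le k-1)$. *)

(* Defs.v *)
From HB Require Import structures.
From mathcomp Require Import all_boot all_order all_algebra.
From mathcomp Require Import complex.
From mathcomp Require Import all_classical all_reals all_analysis.

Set Implicit Arguments.
Unset Strict Implicit.
Unset Printing Implicit Defensive.

Import Order.TTheory GRing.Theory Num.Theory.
Import numFieldNormedType.Exports.

Local Open Scope classical_set_scope.
Local Open Scope ring_scope.

(* The library puts its topology and derivatives on an abstract numeric field,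
   not on the concrete type [R[i]], hence the bundling of the field of complex
   numbers as a [numFieldType] and definitions over an arbitrary [K], all of
   which are meant for [K := complex_field R]. *)
Definition complex_field (R : realType) : numFieldType := R[i].

(* [pseries] is restricted to real coefficients, hence these versions. *)
Definition cpseries (K : numFieldType) (c : nat -> K) (z : K) : nat -> K :=
  [series c k * z ^+ k]_k.

Definition cpsum (K : numFieldType) (c : nat -> K) (z : K) : K :=
  limn (cpseries c z).

(* The exponent [ep] is fixed by ga + de + ep = al + be + 1. *)
Definition heun_eq (K : numFieldType) (a q al be ga de : K)
    (f : K -> K) (z : K) : Prop :=
  let ep := al + be + 1 - ga - de in
  derive1n 2 f z + (ga / z + de / (z - 1) + ep / (z - a)) * derive1 f z
    + (al * be * z - q) / (z * (z - 1) * (z - a)) * f z = 0.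

(* The equation is singular at 0, so it is required on a punctured
   neighbourhood only. The total operator [derive1] takes no junk value here:
   a power series converging near 0 is differentiable to any order there. *)
Definition local_heun_coef (K : numFieldType) (a q al be ga de : K)
    (c : nat -> K) : Prop :=
  [/\ c 0%N = 1,
      \forall z \near (0 : K), cvgn (cpseries c z) &
      \forall z \near (0 : K)^', heun_eq a q al be ga de (cpsum c) z].

(* The coefficient sequence is picked by classical choice; it exists and is
   unique as soon as a <> 0 and gamma is not a nonpositive integer. *)
Definition Hl (K : numFieldType) (a q al be ga de : K) (z : K) : K :=
  cpsum (xget (fun=> 0) [set c | local_heun_coef a q al be ga de c]) z.

Definition u_fun (K : numFieldType) (s : K) (n : nat) (t : K) : K :=
  Hl (-1) (- (n%:R * s / 4)) (- (n%:R / 2)) (- ((n%:R - 1) / 2))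
     (1 / 2) ((1 - n%:R - s) / 2) (t ^+ 2).

Definition v_fun (K : numFieldType) (s : K) (n : nat) (t : K) : K :=
  t * Hl (-1) (- ((n%:R - 2) * s / 4)) (- ((n%:R - 1) / 2))
         (- ((n%:R - 2) / 2)) (3 / 2) ((1 - n%:R - s) / 2) (t ^+ 2).

Section TridiagonalDeterminants.
Variable F : fieldType.

Definition a_coef (x : F) : F := 2 * x * (2 * x - 1).
Definition b_coef (x : F) : F := 2 * x * (2 * x + 1).

(* The tridiagonal matrix with [d i] at (i, i), [up i] at (i, i + 1) and [lo i]
   at (i + 1, i), where positions are counted from 1 and ordinals from 0. *)
Definition tridiag_mx (d up lo : nat -> F) (k : nat) : 'M[F]_k :=
  \matrix_(i < k, j < k)
    if (j == i :> nat) then d i.+1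
    else if (j == i.+1 :> nat) then up i.+1
    else if (i == j.+1 :> nat) then lo j.+1
    else 0.

(* The 0 x 0 determinant is 1, which gives P_0 = Q_0 = 1. *)
Definition P_poly (k : nat) (x y : F) : F :=
  \det (tridiag_mx (fun i => (y - 4 * (i%:R - 1)) * x)
                   (fun i => a_coef i%:R)
                   (fun i => - a_coef ((y - 2 * i%:R + 2) / 2)) k).

Definition Q_poly (k : nat) (x y : F) : F :=
  \det (tridiag_mx (fun i => (y - 2 - 4 * (i%:R - 1)) * x)
                   (fun i => b_coef i%:R)
                   (fun i => - b_coef ((y - 2 * i%:R) / 2)) k).

End TridiagonalDeterminants.

(* Main.v *)
Require Import Defs.
From HB Require Import structures.
From mathcomp Require Import all_boot all_order all_algebra.
From mathcomp Require Import complex ring zify.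
From mathcomp Require Import all_classical all_reals all_analysis.

Import Order.TTheory GRing.Theory Num.Theory.
Import numFieldNormedType.Exports.

Local Open Scope classical_set_scope.
Local Open Scope ring_scope.

(** Write the unknown solution as a power series [c] and multiply Heun's equation
    by [z (z - 1) (z - a)]: all terms become power series, and comparing the
    coefficients of [z ^+ k] turns the equation into the three-term recurrence
      [a (k + 1) (k + ga) c_(k+1) = (...) c_k - (k - 1 + al) (k - 1 + be) c_(k-1)].
    A tridiagonal determinant obeys a three-term recurrence too, by expansion
    along its last row ([det_tridiag_mxSS]). For the parameters of [u_fun] and
    [v_fun], dividing by [(2 k)!] and [(2 k + 1)!] makes the two recurrences the
    same one ([u_coef_residual], [v_coef_residual]), and both start with [1].

    What remains is the analysis that justifies comparing coefficients. It uses
    a single tool, domination by a geometric series: [|c k| <= M * rho ^+ k].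
    Every power series that converges at some point other than 0 satisfies such
    a bound ([cvgn_geom_bounded]), and so does every solution of the recurrence
    as soon as [k + ga] grows linearly ([heun_residual_geom_bounded]). Under such
    a bound the series converges and may be differentiated term by term near 0
    ([derive1_cpsum], [derive1n2_cpsum]), so that Heun's equation near 0 says
    that the series of residuals of the recurrence sums to 0
    ([near_heun_eq_residual]); by the identity theorem ([cpseries_eq0]) all the
    residuals then vanish. The recurrence has one solution with [c 0 = 1], hence
    the sequence chosen in the definition of [Hl] is that solution
    ([Hl_cpsum]).

    All this is done over a field [K] in which series dominated by a geometric
    series of ratio 1/2 converge; for the complex numbers this follows from the
    real case applied to real and imaginary parts ([half_complete_complex]). *)

Set Implicit Arguments.
Unset Strict Implicit.
Unset Printing Implicit Defensive.

(** * Bounds for sequences and series *)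

Section Bounds.
Variable K : numFieldType.
Implicit Types (u : nat -> K) (M B l : K).

(** The order of [K] is only partial, but [`|l|] and [B] are real, hence
    comparable. *)
Lemma cvgn_norm_le u l B :
  (forall n, `|u n| <= B) -> u @ \oo --> l -> `|l| <= B.
Proof.
move=> uB ul.
have B0 : 0 <= B by apply: le_trans (uB 0%N).
rewrite real_leNgt ?ger0_real//; apply/negP => Bl.
have d0 : 0 < `|l| - B by rewrite subr_gt0.
move/cvgrPdist_lt : ul => /(_ _ d0) [N _ /(_ N (leqnn N))] /= H.
have := lt_le_trans H (lerB (lexx _) (uB N)).
by move/lt_le_trans/(_ (lerB_dist _ _)); rewrite ltxx.
Qed.

(** The stronger bound [2 M (1 - 2^-n)] is what the induction preserves. *)
Lemma series_half_le u M n :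
  (forall k, `|u k| <= M * 2^-1 ^+ k) -> `|series u n| <= 2 * M.
Proof.
move=> uM.
have M0 : 0 <= M by move: (uM 0%N); rewrite expr0 mulr1; apply: le_trans.
suff : `|series u n| <= 2 * M * (1 - 2^-1 ^+ n).
  move=> /le_trans; apply; apply: ler_piMr; first by rewrite mulr_ge0.
  by rewrite gerBl exprn_ge0// invr_ge0.
elim: n => [|n IH].
  by rewrite seriesEnat/= big_geq// normr0 expr0 subrr mulr0.
rewrite seriesSr; apply: le_trans (ler_normD _ _) _.
apply: le_trans (lerD IH (uM n)) _.
rewrite le_eqVlt; apply/orP; left; apply/eqP.
by rewrite exprS; field.
Qed.

End Bounds.

(** The only form of completeness that power series near 0 require. Any other
    ratio can be brought to 1/2 by shrinking the radius, and for this fixed ratio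
    the bound [2 * M] on the partial sums is pure algebra. *)
Definition half_complete (K : numFieldType) : Prop :=
  forall (u : nat -> K) M,
    (forall k, `|u k| <= M * 2^-1 ^+ k) -> cvgn (series u).

Definition geom_bounded (K : numFieldType) (c : nat -> K) (M rho : K) : Prop :=
  forall k, `|c k| <= M * rho ^+ k.

(** The coefficients of the termwise derivative. *)
Definition dcoef (K : numFieldType) (c : nat -> K) : nat -> K :=
  fun k => k.+1%:R * c k.+1.

(** The coefficients of [z] times the power series. *)
Definition shift (K : numFieldType) (c : nat -> K) : nat -> K :=
  fun k => if k is j.+1 then c j else 0.

(** * Operations on power series *)

Section PowerSeries.
Variable K : numFieldType.
Implicit Types (c d : nat -> K) (z l : K).

Lemma cpseries_add c d z l l' :
  cpseries c z @ \oo --> l -> cpseries d z @ \oo --> l' ->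
  cpseries (fun k => c k + d k) z @ \oo --> l + l'.
Proof.
move=> cl dl.
suff -> : cpseries (fun k => c k + d k) z = cpseries c z + cpseries d z.
  exact: cvgD.
by rewrite /cpseries -seriesD; congr series; apply/funext => k /=;
  rewrite mulrDl.
Qed.

Lemma cpseries_scale a c z l :
  cpseries c z @ \oo --> l -> cpseries (fun k => a * c k) z @ \oo --> a * l.
Proof.
move=> cl.
suff -> : cpseries (fun k => a * c k) z = a *: cpseries c z by exact: cvgZr.
by rewrite /cpseries -seriesZ; congr series; apply/funext => k /=;
  rewrite -mulrA.
Qed.

Lemma cpseries_shift c z l :
  cpseries c z @ \oo --> l -> cpseries (shift c) z @ \oo --> z * l.
Proof.
move=> cl; rewrite -cvg_shiftS /=.
suff -> : (fun n => cpseries (shift c) z n.+1) = (fun n => z *: cpseries c z n).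
  exact: cvgZr.
apply/funext => n.
rewrite /cpseries /= !seriesEnat /= big_nat_recl//= mul0r add0r scaler_sumr.
by apply: eq_bigr => k _; rewrite exprS /GRing.scale/= mulrCA.
Qed.

Lemma cpseries_tail c z l : z != 0 ->
  cpseries c z @ \oo --> l ->
  cpseries (fun k => c k.+1) z @ \oo --> (l - c 0%N) / z.
Proof.
move=> z0; rewrite -cvg_shiftS /= => cl.
suff -> : cpseries (fun k => c k.+1) z =
    (fun n => z^-1 *: (cpseries c z n.+1 - c 0%N)).
  by rewrite mulrC; apply: cvgZr; apply: cvgB => //; exact: cvg_cst.
apply/funext => n; rewrite /cpseries /= !seriesEnat /= big_nat_recl//=.
rewrite expr0 mulr1 addrC addKr scaler_sumr.
by apply: eq_bigr => k _; rewrite exprS /GRing.scale/= mulrCA; congr (_ * _);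
  rewrite mulKf.
Qed.

Lemma cpsum_eq c z l : cpseries c z @ \oo --> l -> cpsum c z = l.
Proof. by move=> cl; apply: cvg_lim => //; exact: norm_hausdorff. Qed.

End PowerSeries.
Arguments cpseries_scale {K} a {c z l}.

(** * Geometrically bounded coefficients and the identity theorem *)

Section Convergent.
Variable K : numFieldType.
Implicit Types (c : nat -> K) (M rho z l : K).

Lemma geom_bounded_ge0 c M rho : geom_bounded c M rho -> 0 <= M.
Proof. by move=> /(_ 0%N); rewrite expr0 mulr1; apply: le_trans. Qed.

Lemma geom_term_le c M rho z : 0 <= rho -> geom_bounded c M rho ->
  rho * `|z| <= 2^-1 -> forall k, `|c k * z ^+ k| <= M * 2^-1 ^+ k.
Proof.
move=> rho0 cM zr k; rewrite normrM normrX.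
apply: le_trans (ler_wpM2r _ (cM k)) _; first by rewrite exprn_ge0.
have M0 := geom_bounded_ge0 cM.
by rewrite -mulrA -exprMn ler_wpM2l// lerXn2r// nnegrE ?mulr_ge0.
Qed.

Lemma cpsum_norm_le c M rho z l : 0 <= rho -> geom_bounded c M rho ->
  rho * `|z| <= 2^-1 -> cpseries c z @ \oo --> l -> `|l| <= 2 * M.
Proof.
move=> rho0 cM zr; apply: cvgn_norm_le => n; apply: series_half_le.
exact: geom_term_le zr.
Qed.

Lemma geom_bounded_tail c M rho : geom_bounded c M rho ->
  geom_bounded (fun k => c k.+1) (M * rho) rho.
Proof. by move=> cM k; rewrite -mulrA -exprS. Qed.

(** The factor [k + 1] is absorbed by doubling the ratio, as [k + 1 <= 2 ^ k]. *)
Lemma geom_bounded_dcoef c M rho : 0 <= rho -> geom_bounded c M rho ->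
  geom_bounded (dcoef c) (M * rho) (2 * rho).
Proof.
move=> rho0 cM k; rewrite /dcoef normrM normr_nat exprMn.
apply: le_trans (ler_wpM2l _ (cM k.+1)) _ => //.
have M0 := geom_bounded_ge0 cM.
have -> : M * rho * (2 ^+ k * rho ^+ k) = 2 ^+ k * (M * rho ^+ k.+1).
  by rewrite exprS; ring.
rewrite ler_wpM2r ?mulr_ge0 ?exprn_ge0// -natrX ler_nat.
by elim: k => // k IH; rewrite expnS mul2n -addnn -addn1 leq_add// expn_gt0.
Qed.

(** Convergence at one point other than 0 already bounds the coefficients
    geometrically, because the terms there tend to 0. *)
Lemma cvgn_geom_bounded c z : z != 0 -> cvgn (cpseries c z) ->
  exists M rho, 0 < rho /\ geom_bounded c M rho.
Proof.
move=> z0 /cvg_series_cvg_0 cz.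
have [M M0 cM] : exists2 M, 0 < M & forall k, `|c k * z ^+ k| <= M.
  have /cvg_seq_bounded := cvgP _ cz.
  by move=> /pinfty_ex_gt0 [M M0 /= H]; exists M => // k; exact: H.
exists M, `|z|^-1; split; first by rewrite invr_gt0 normr_gt0.
move=> k; rewrite exprVn ler_pdivlMr ?exprn_gt0 ?normr_gt0//.
by rewrite -normrX -normrM.
Qed.

(** For [z != 0] the tail [c 1 + c 2 z + ...] has sum [- c 0 / z] and is bounded
    near 0, hence [c 0] is arbitrarily small. *)
Lemma cpseries_eq0_head c :
  (\forall z \near (0 : K)^', cpseries c z @ \oo --> 0) -> c 0%N = 0.
Proof.
move=> c0.
have [M [rho [rho0 cM]]] : exists M rho, 0 < rho /\ geom_bounded c M rho.
  near (0 : K)^' => z; apply: (@cvgn_geom_bounded _ z).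
    by near: z; exact: nbhs_dnbhs_neq.
  by apply/cvg_ex; exists 0; near: z.
have M0 := geom_bounded_ge0 cM.
have D0 : 0 < 2 * (M * rho) + 1 by rewrite ltr_wpDl// !mulr_ge0// ltW.
apply/eqP; apply: contraT; rewrite -normr_gt0 => c00.
near (0 : K)^' => z.
have z0 : z != 0 by near: z; exact: nbhs_dnbhs_neq.
have /(cpseries_tail z0) cz : cpseries c z @ \oo --> 0 by near: z.
have zr : rho * `|z| <= 2^-1.
  rewrite -ler_pdivlMl//; near: z; apply: dnbhs0_le.
  by rewrite mulr_gt0// invr_gt0.
have := cpsum_norm_le (ltW rho0) (geom_bounded_tail cM) zr cz.
rewrite sub0r normrM normrN normfV ler_pdivrMr ?normr_gt0// => H.
have zs : `|z| < `|c 0%N| / (2 * (M * rho) + 1).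
  by near: z; apply: dnbhs0_lt; rewrite divr_gt0.
move: zs; rewrite ltr_pdivlMr// => /lt_le_trans/(_ H).
by rewrite mulrDr mulr1 mulrC gtrDl normr_lt0.
Unshelve. all: by end_near. Qed.

(** Once [c 0 = 0], dividing by [z] shows that the series of the [c k.+1] vanishes
    near 0 as well. Only a punctured neighbourhood is assumed, since this is where
    Heun's equation holds. *)
Lemma cpseries_eq0 c : (\forall z \near (0 : K)^', cpseries c z @ \oo --> 0) ->
  forall k, c k = 0.
Proof.
move=> c0 k; elim: k c c0 => [|k IH] c c0; first exact: cpseries_eq0_head.
apply: (IH (fun k => c k.+1)); near=> z.
have z0 : z != 0 by near: z; exact: nbhs_dnbhs_neq.
have /(cpseries_tail z0) : cpseries c z @ \oo --> 0 by near: z.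
by rewrite (cpseries_eq0_head c0) subrr mul0r.
Unshelve. all: by end_near. Qed.

End Convergent.

(** * Termwise differentiation *)

Section Derivative.
Variable K : numFieldType.
Hypothesis Kc : half_complete K.
Implicit Types (c : nat -> K) (M rho z w h e r : K).

Lemma geom_cvg c M rho z : 0 <= rho -> geom_bounded c M rho ->
  rho * `|z| <= 2^-1 -> cpseries c z @ \oo --> cpsum c z.
Proof. by move=> rho0 cM zr; apply: Kc (geom_term_le rho0 cM zr). Qed.

(** The polynomial [((z + h) ^+ k - z ^+ k - h k z ^+ (k - 1)) / h ^+ 2], defined
    by a recursion that avoids the division and yields the bound below. *)
Fixpoint taylor_rem2 z h k : K :=
  if k is j.+1 then (z + h) * taylor_rem2 z h j + j%:R * z ^+ j.-1 else 0.

Lemma taylor_rem2E z h k :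
  (z + h) ^+ k = z ^+ k + h * (k%:R * z ^+ k.-1) + h ^+ 2 * taylor_rem2 z h k.
Proof.
elim: k => [|k IH]; first by rewrite /= mul0r !mulr0 !addr0.
rewrite exprS IH /=; case: k {IH} => [|k] /=; first by ring.
by rewrite !exprS -!(natr1 k.+1) -!(natr1 k); ring.
Qed.

Lemma taylor_rem2_le z h r k : `|z| <= r -> `|z + h| <= r ->
  `|taylor_rem2 z h k| * r ^+ 2 <= (2 * r) ^+ k.
Proof.
move=> zr zhr; have r0 : 0 <= r by apply: le_trans zr.
elim: k => [|k IH]; first by rewrite /= normr0 mul0r.
rewrite /=; apply: le_trans (ler_wpM2r _ (ler_normD _ _)) _.
  by rewrite exprn_ge0.
rewrite mulrDl normrM -mulrA.
have H1 : `|z + h| * (`|taylor_rem2 z h k| * r ^+ 2) <= r * (2 * r) ^+ k.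
  by apply: ler_pM => //; rewrite mulr_ge0 ?exprn_ge0.
have H2 : `|k%:R * z ^+ k.-1| * r ^+ 2 <= k%:R * r ^+ k.+1.
  case: k {IH H1} => [|k]; first by rewrite !mul0r normr0 mul0r.
  rewrite normrM normr_nat normrX -mulrA ler_wpM2l//=.
  by rewrite -(addn2 k) exprD ler_wpM2r ?exprn_ge0// lerXn2r ?nnegrE.
apply: le_trans (lerD H1 H2) _.
rewrite !exprMn mulrCA -exprS -mulrDl ler_wpM2r ?exprn_ge0// exprS.
have -> : 2 * 2 ^+ k = 2 ^+ k + 2 ^+ k :> K by ring.
rewrite lerD2l -natrX ler_nat.
by apply: ltnW; exact: ltn_expl.
Qed.

(** Both points stay in the disc of radius [r = 1 / (4 rho)]: there the terms of
    the remainder are at most [M rho ^+ k (2 r) ^+ k / r ^+ 2], a geometric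
    series of ratio 1/2. *)
Lemma cpsum_taylor1 c M rho z h : 0 < rho -> geom_bounded c M rho ->
  `|z| <= (4 * rho)^-1 -> `|z + h| <= (4 * rho)^-1 ->
  `|cpsum c (z + h) - cpsum c z - h * cpsum (dcoef c) z|
    <= `|h| ^+ 2 * (2 * M * (4 * rho) ^+ 2).
Proof.
move=> rho0; set r := (4 * rho)^-1 => cM zr zhr.
have r0 : 0 < r by rewrite invr_gt0 mulr_gt0.
have rr : 2 * rho * r = 2^-1 by rewrite /r; field; rewrite gt_eqF.
have small w : `|w| <= r -> rho * `|w| <= 2^-1.
  move=> wr; apply: le_trans (ler_wpM2l (ltW rho0) wr) _.
  by rewrite -rr -mulrA ler_peMl ?mulr_ge0 ?(ltW rho0) ?(ltW r0)// ler1n.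
have c1 := geom_cvg (ltW rho0) cM (small _ zhr).
have c2 := geom_cvg (ltW rho0) cM (small _ zr).
have c3 : cpseries (dcoef c) z @ \oo --> cpsum (dcoef c) z.
  apply: (geom_cvg _ (geom_bounded_dcoef (ltW rho0) cM)).
    by rewrite mulr_ge0// ltW.
  by rewrite -rr ler_wpM2l// mulr_ge0// ltW.
(* [c 0] contributes the term 0, so the partial sums agree up to a shift. *)
have c4 : series (fun k => c k * (k%:R * z ^+ k.-1)) @ \oo --> cpsum (dcoef c) z.
  rewrite -cvg_shiftS /=; apply: cvg_trans c3; apply: near_eq_cvg.
  near=> n; rewrite /cpseries !seriesEnat /= big_nat_recl//= mul0r mulr0 add0r.
  by apply: eq_bigr => k _; rewrite /dcoef mulrCA mulrA.
have c5 : h *: series (fun k => c k * (k%:R * z ^+ k.-1)) @ \oo -->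
    h * cpsum (dcoef c) z by exact: cvgZr.
have : cpseries c (z + h) - cpseries c z -
    h *: series (fun k => c k * (k%:R * z ^+ k.-1)) @ \oo -->
    cpsum c (z + h) - cpsum c z - h * cpsum (dcoef c) z.
  by apply: cvgB => //; exact: cvgB.
rewrite /cpseries -seriesZ -!seriesN -!seriesD; apply: cvgn_norm_le => n.
rewrite mulrCA -mulrA; apply: series_half_le => k.
have rV : r ^- 2 = (4 * rho) ^+ 2 by rewrite /r exprVn invrK.
have -> : M * (`|h| ^+ 2 * (4 * rho) ^+ 2) * 2^-1 ^+ k
   = `|h| ^+ 2 * (M * rho ^+ k * ((2 * r) ^+ k * r ^- 2)).
  by rewrite -rr rV !exprMn; ring.
rewrite -[X in `|X|]/(c k * (z + h) ^+ k - c k * z ^+ k -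
                      h * (c k * (k%:R * z ^+ k.-1))).
have -> : c k * (z + h) ^+ k - c k * z ^+ k - h * (c k * (k%:R * z ^+ k.-1))
    = h ^+ 2 * (c k * taylor_rem2 z h k) by rewrite taylor_rem2E; ring.
rewrite normrM normrX ler_wpM2l ?exprn_ge0// normrM ler_pM//.
by rewrite ler_pdivlMr ?exprn_gt0// taylor_rem2_le.
Unshelve. all: by end_near. Qed.

(** For a function that agrees with the power series on the disc only, so that
    the lemma can be iterated. *)
Lemma derive1_cpsum f c M rho z : 0 < rho -> geom_bounded c M rho ->
  (forall w, `|w| < (4 * rho)^-1 -> f w = cpsum c w) ->
  `|z| < (4 * rho)^-1 -> derive1 f z = cpsum (dcoef c) z.
Proof.
move=> rho0 cM fE zr; apply: cvg_lim; first exact: norm_hausdorff.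
have M0 := geom_bounded_ge0 cM.
have C0 : 0 < 2 * M * (4 * rho) ^+ 2 + 1.
  by rewrite ltr_wpDl// !mulr_ge0// ltW.
apply/(@cvgrPdist_le _ K^o) => e e0; near=> h.
have h0 : h != 0 by near: h; exact: nbhs_dnbhs_neq.
have zhr : `|z + h| < (4 * rho)^-1.
  apply: le_lt_trans (ler_normD _ _) _; rewrite addrC -ltrBrDr.
  by near: h; apply: dnbhs0_lt; rewrite subr_gt0.
rewrite (addrC h) (fE _ zhr) (fE _ zr) distrC /GRing.scale/=.
have -> : h^-1 * (cpsum c (z + h) - cpsum c z) - cpsum (dcoef c) z =
    h^-1 * (cpsum c (z + h) - cpsum c z - h * cpsum (dcoef c) z) by field.
rewrite normrM normfV ler_pdivrMl ?normr_gt0//.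
apply: le_trans (cpsum_taylor1 rho0 cM (ltW zr) (ltW zhr)) _.
rewrite expr2 -mulrA ler_wpM2l//.
(* Adding 1 makes the constant positive, so that one can divide by it. *)
apply: (@le_trans _ _ (`|h| * (2 * M * (4 * rho) ^+ 2 + 1))).
  by rewrite ler_wpM2l// lerDl.
rewrite -ler_pdivlMr//; near: h.
by apply: dnbhs0_le; rewrite divr_gt0.
Unshelve. all: by end_near. Qed.

Lemma derive1n2_cpsum c M rho z : 0 < rho -> geom_bounded c M rho ->
  `|z| < (8 * rho)^-1 ->
  derive1n 2 (cpsum c) z = cpsum (dcoef (dcoef c)) z.
Proof.
move=> rho0 cM zr.
have r8 : (4 * (2 * rho))^-1 = (8 * rho)^-1 by congr _^-1; ring.
apply: (derive1_cpsum _ (geom_bounded_dcoef (ltW rho0) cM)).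
- by rewrite mulr_gt0.
- rewrite r8 => w wr; apply: (derive1_cpsum rho0 cM) => //.
  apply: lt_le_trans wr _; rewrite lef_pV2 ?posrE ?mulr_gt0//.
  by rewrite ler_wpM2r ?(ltW rho0)// ler_nat.
- by rewrite r8.
Qed.

End Derivative.

(** * Heun's equation and its recurrence *)

Section Heun.
Variable K : numFieldType.
Hypothesis Kc : half_complete K.
Variables a q al be ga de : K.
Implicit Types (c d : nat -> K) (M rho z : K).

Let ep := al + be + 1 - ga - de.

(** The coefficient of [z ^+ k] in [z (z - 1) (z - a)] times the left-hand side of
    Heun's equation, [c] being the coefficients of the unknown function. *)
Definition heun_residual c : nat -> K := fun k =>
  a * (k.+1%:R * (k%:R + ga)) * c k.+1
  - (k%:R * ((k%:R - 1) * (1 + a) + ga * (1 + a) + de * a + ep) + q) * c k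
  + (k%:R - 1 + al) * (k%:R - 1 + be) * shift c k.

(** The polynomial coefficients are expanded in powers of [z], each power acting
    on coefficient sequences as an iterate of [shift]. *)
Lemma cpseries_heun_residual c z (f f1 f2 : K) :
  cpseries c z @ \oo --> f -> cpseries (dcoef c) z @ \oo --> f1 ->
  cpseries (dcoef (dcoef c)) z @ \oo --> f2 ->
  cpseries (heun_residual c) z @ \oo -->
    z * (z - 1) * (z - a) * f2
    + (ga * ((z - 1) * (z - a)) + de * (z * (z - a)) + ep * (z * (z - 1))) * f1
    + (al * be * z - q) * f.
Proof.
move=> cf cf1 cf2.
have s1 := cpseries_shift cf.
have t1 := cpseries_shift cf1; have t2 := cpseries_shift t1.
have w1 := cpseries_shift cf2; have w2 := cpseries_shift w1.
have w3 := cpseries_shift w2.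
have := cpseries_add
  (cpseries_add
    (cpseries_add (cpseries_scale a w1)
      (cpseries_add (cpseries_scale (- (1 + a)) w2) w3))
    (cpseries_add (cpseries_scale (ga * a) cf1)
      (cpseries_add (cpseries_scale (- (ga * (1 + a) + de * a + ep)) t1)
                    (cpseries_scale (ga + de + ep) t2))))
  (cpseries_add (cpseries_scale (- q) cf) (cpseries_scale (al * be) s1)).
set d := (X in cpseries X z); set l := (X in _ --> X).
have -> : l = z * (z - 1) * (z - a) * f2
    + (ga * ((z - 1) * (z - a)) + de * (z * (z - a)) + ep * (z * (z - 1))) * f1
    + (al * be * z - q) * f by rewrite /l; ring.
suff -> : d = heun_residual c by [].
apply/funext => k; rewrite /d /heun_residual /dcoef /ep.
case: k => [|[|[|k]]] /=; ring.
Qed.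

Lemma heun_eq_residual c M rho z : 0 < rho -> geom_bounded c M rho ->
  `|z| < (8 * rho)^-1 -> z != 0 -> z != 1 -> z != a ->
  heun_eq a q al be ga de (cpsum c) z <->
  cpseries (heun_residual c) z @ \oo --> 0.
Proof.
move=> rho0 cM zr z0 z1 za.
have zr4 : `|z| < (4 * rho)^-1.
  apply: lt_le_trans zr _; rewrite lef_pV2 ?posrE ?mulr_gt0//.
  by rewrite ler_wpM2r ?(ltW rho0)// ler_nat.
have cM1 := geom_bounded_dcoef (ltW rho0) cM.
have rho1 : 0 <= 2 * rho by rewrite mulr_ge0// ltW.
have cM2 := geom_bounded_dcoef rho1 cM1.
have zr1 : rho * 4 * `|z| <= 2^-1.
  have -> : 2^-1 = rho * 4 * (8 * rho)^-1 :> K by field; rewrite gt_eqF.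
  by rewrite ler_wpM2l ?mulr_ge0 ?ltW.
have small n : (n <= 4)%N -> n%:R * rho * `|z| <= 2^-1.
  move=> n4; apply: le_trans zr1; rewrite mulrC [leRHS]mulrC ler_wpM2l//.
  by rewrite mulrC ler_wpM2l ?ler_nat// ltW.
have cf : cpseries c z @ \oo --> cpsum c z.
  by apply: (geom_cvg Kc (ltW rho0) cM); have := small 1%N isT; rewrite mul1r.
have cf1 : cpseries (dcoef c) z @ \oo --> cpsum (dcoef c) z.
  by apply: (geom_cvg Kc _ cM1) => //; exact: small.
have cf2 : cpseries (dcoef (dcoef c)) z @ \oo --> cpsum (dcoef (dcoef c)) z.
  apply: (geom_cvg Kc _ cM2); first by rewrite mulr_ge0.
  by rewrite mulrA -natrM; exact: small.
have := cpseries_heun_residual cf cf1 cf2.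
rewrite /heun_eq (derive1n2_cpsum Kc rho0 cM zr).
rewrite (derive1_cpsum Kc rho0 cM (fun _ _ => erefl) zr4).
set f2 := cpsum (dcoef (dcoef c)) z; set f1 := cpsum (dcoef c) z.
set f := cpsum c z; set l := (X in _ --> X) => cl.
have z10 : z - 1 != 0 by rewrite subr_eq0.
have za0 : z - a != 0 by rewrite subr_eq0.
set E := (X in X = 0 <-> _).
have lE : l = z * (z - 1) * (z - a) * E.
  by rewrite /l /E /ep; field; rewrite z0 z10 za0.
split => [E0|r0]; first by move: cl; rewrite lE E0 mulr0.
have l0 : l = 0 by rewrite -(cpsum_eq cl) (cpsum_eq r0).
move/eqP: lE; rewrite l0 eq_sym mulf_eq0 !mulf_eq0 (negPf z0) (negPf z10).
by rewrite (negPf za0) /= => /eqP.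
Qed.

Hypothesis a0 : a != 0.

(** Near 0 the other singular points [1] and [a] are avoided. *)
Lemma near_heun_eq_residual c M rho : 0 < rho -> geom_bounded c M rho ->
  \forall z \near (0 : K)^', heun_eq a q al be ga de (cpsum c) z <->
    cpseries (heun_residual c) z @ \oo --> 0.
Proof.
move=> rho0 cM; near=> z; apply: (heun_eq_residual rho0 cM).
- by near: z; apply: dnbhs0_lt; rewrite invr_gt0 mulr_gt0.
- by near: z; exact: nbhs_dnbhs_neq.
- suff : `|z| < 1 by apply: contraTneq => ->; rewrite normr1 ltxx.
  by near: z; exact: dnbhs0_lt.
- suff : `|z| < `|a| by apply: contraTneq => ->; rewrite ltxx.
  by near: z; apply: dnbhs0_lt; rewrite normr_gt0.
Unshelve. all: by end_near. Qed.

Lemma local_heun_coef_residual c :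
  local_heun_coef a q al be ga de c -> forall k, heun_residual c k = 0.
Proof.
case=> _ ccv ceq.
have [M [rho [rho0 cM]]] : exists M rho, 0 < rho /\ geom_bounded c M rho.
  near (0 : K)^' => z; apply: (@cvgn_geom_bounded _ _ z).
    by near: z; exact: nbhs_dnbhs_neq.
  by near: z; exact: nbhs_dnbhs.
have eqE := near_heun_eq_residual rho0 cM.
apply: cpseries_eq0; near=> z.
have [ez _] : heun_eq a q al be ga de (cpsum c) z <->
    cpseries (heun_residual c) z @ \oo --> 0 by near: z.
by apply: ez; near: z.
Unshelve. all: by end_near. Qed.

Lemma residual_local_heun_coef c M rho : 0 < rho -> geom_bounded c M rho ->
  c 0%N = 1 -> (forall k, heun_residual c k = 0) ->
  local_heun_coef a q al be ga de c.
Proof.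
move=> rho0 cM c0 cr; split => //.
  near=> z; apply/cvg_ex; exists (cpsum c z); apply: (geom_cvg Kc (ltW rho0) cM).
  rewrite -ler_pdivlMl//; near: z; apply: (@nbhs0_le K K^o).
  by rewrite mulr_gt0// invr_gt0.
apply: filterS (near_heun_eq_residual rho0 cM) => z [_]; apply.
suff -> : cpseries (heun_residual c) z = cst 0 by exact: cvg_cst.
apply/funext => n; rewrite /cpseries seriesEnat /= big1// => k _.
by rewrite cr mul0r.
Unshelve. all: by end_near. Qed.

(** The leading coefficient [a (k + 1) (k + ga)] does not vanish, so each term is
    determined by the two before it. *)
Lemma heun_residual_inj c d : (forall k, k%:R + ga != 0) -> c 0%N = d 0%N ->
  (forall k, heun_residual c k = 0) -> (forall k, heun_residual d k = 0) ->
  c = d.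
Proof.
move=> gaN c0 cr dr; apply/funext => k.
suff [] : c k = d k /\ shift c k = shift d k by [].
elim: k => [|k [IH1 IH2]]; first by [].
split=> //; have := cr k; rewrite -(dr k) /heun_residual IH1 IH2.
move=> /addIr/addIr; apply: mulfI.
by rewrite !mulf_neq0// pnatr_eq0.
Qed.

(** In the recurrence the coefficients of [c k] and [c k.-1] grow at most
    quadratically in [k] and, by the hypothesis, that of [c k.+1] grows at least
    quadratically; hence [c k.+1] is at most a constant [L] times the larger of
    the two previous terms, in norm. *)
Lemma heun_residual_geom_bounded c (kap : K) :
  (forall k, k.+1%:R <= kap * `|k%:R + ga|) ->
  c 0%N = 1 -> (forall k, heun_residual c k = 0) ->
  exists2 rho, 0 < rho & geom_bounded c 1 rho.
Proof.
move=> gak c0 cr.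
have kap0 : 0 <= kap.
  have := gak 0%N; rewrite add0r => /(lt_le_trans ltr01) H.
  have g0 : 0 < `|ga|.
    by rewrite normr_gt0; apply: contraTneq H => ->; rewrite normr0 mulr0 ltxx.
  by apply: ltW; move: H; rewrite pmulr_lgt0.
pose B := ga * (1 + a) + de * a + ep.
pose L1 : K := `|1 + a| + `|B| + `|q|; pose L2 : K := (1 + `|al|) * (1 + `|be|).
pose L := kap / `|a| * (L1 + L2).
have L10 : 0 <= L1 by rewrite !addr_ge0.
have L20 : 0 <= L2 by rewrite mulr_ge0// addr_ge0.
have L0 : 0 <= L by rewrite mulr_ge0 ?divr_ge0 ?addr_ge0.
have k1 (k : nat) : `|k%:R - 1 : K| <= k.+1%:R.
  by apply: le_trans (ler_normB _ _) _; rewrite normr_nat normr1 natr1.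
have k0 (k : nat) : k%:R <= k.+1%:R :> K by rewrite ler_nat.
have kpos (k : nat) : 1 <= k.+1%:R :> K by rewrite ler1n.
have step k (x : K) : 0 <= x -> `|c k| <= x -> `|shift c k| <= x ->
    `|c k.+1| <= L * x.
  move=> x0 cx sx.
  have /eqP := cr k; rewrite /heun_residual -addrA addr_eq0 opprD opprK.
  move=> /eqP/(congr1 Num.norm); rewrite !normrM normr_nat => E.
  have U1 :
    `|(k%:R * ((k%:R - 1) * (1 + a) + ga * (1 + a) + de * a + ep) + q) * c k|
     <= k.+1%:R ^+ 2 * L1 * x.
    rewrite normrM ler_pM//.
    have -> : k%:R * ((k%:R - 1) * (1 + a) + ga * (1 + a) + de * a + ep) + q
       = k%:R * ((k%:R - 1) * (1 + a) + B) + q by rewrite /B; ring.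
    apply: le_trans (ler_normD _ _) _.
    rewrite [leRHS]mulrDr lerD//; last by rewrite ler_peMl// exprn_ege1.
    rewrite normrM normr_nat expr2 -mulrA ler_pM//.
    apply: le_trans (ler_normD _ _) _.
    by rewrite [leRHS]mulrDr lerD// ?ler_peMl// normrM ler_wpM2r.
  have U2 (y : K) : `|k%:R - 1 + y| <= k.+1%:R * (1 + `|y|).
    apply: le_trans (ler_normD _ _) _.
    by rewrite [leRHS]mulrDr mulr1 lerD// ler_peMl.
  have U3 : `|(k%:R - 1 + al) * (k%:R - 1 + be) * shift c k|
     <= k.+1%:R ^+ 2 * L2 * x.
    rewrite !normrM ler_pM// ?mulr_ge0//.
    by rewrite /L2 expr2 mulrACA ler_pM.
  have U : `|a| * (k.+1%:R * `|k%:R + ga|) * `|c k.+1| <=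
      k.+1%:R ^+ 2 * (L1 + L2) * x.
    rewrite E; apply: le_trans (ler_normB _ _) _.
    by rewrite [_ ^+ 2 * _]mulrDr [leRHS]mulrDl lerD.
  have aP : 0 < `|a| by rewrite normr_gt0.
  have kP : 0 < k.+1%:R :> K by [].
  have gP : 0 < `|k%:R + ga|.
    rewrite lt0r normr_ge0 andbT; apply: contraTneq (gak k) => ->.
    by rewrite mulr0 lern0.
  have P0 : 0 < `|a| * (k.+1%:R * `|k%:R + ga|) by rewrite !mulr_gt0.
  rewrite -(ler_pM2l P0); apply: le_trans U _.
  have -> : `|a| * (k.+1%:R * `|k%:R + ga|) * (L * x) =
      k.+1%:R * (kap * `|k%:R + ga|) * (L1 + L2) * x.
    by rewrite /L; field; rewrite gt_eqF.
  by rewrite ler_wpM2r// ler_wpM2r ?addr_ge0// expr2 ler_wpM2l.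
exists (1 + L); first by rewrite ltr_pwDl.
move=> k; rewrite mul1r.
suff [] : `|c k| <= (1 + L) ^+ k /\ `|shift c k| <= (1 + L) ^+ k by [].
have up (j : nat) : (1 + L) ^+ j <= (1 + L) ^+ j.+1.
  by rewrite exprS ler_peMl ?exprn_ge0 ?addr_ge0// lerDl.
elim: k => [|k [IH1 IH2]]; first by rewrite /= c0 normr1 normr0 expr0.
split; last exact: le_trans IH1 (up k).
apply: le_trans (step k _ _ IH1 IH2) _; first by rewrite exprn_ge0 ?addr_ge0.
by rewrite exprS ler_wpM2r ?exprn_ge0 ?addr_ge0// lerDr.
Qed.

(** Existence makes the classical choice in [Hl] pick a sequence satisfying the
    specification, and uniqueness identifies this sequence. *)
Lemma Hl_cpsum c (kap : K) : (forall k, k.+1%:R <= kap * `|k%:R + ga|) ->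
  c 0%N = 1 -> (forall k, heun_residual c k = 0) ->
  Hl a q al be ga de = cpsum c /\ \forall z \near (0 : K), cvgn (cpseries c z).
Proof.
move=> gak c0 cr.
have [rho rho0 cM] := heun_residual_geom_bounded gak c0 cr.
have cH := residual_local_heun_coef rho0 cM c0 cr.
have gaN k : k%:R + ga != 0.
  by apply: contraTneq (gak k) => ->; rewrite normr0 mulr0 lern0.
split; last by case: (cH).
apply/funext => z; rewrite /Hl; congr cpsum.
apply: xget_unique => // d dH.
apply: heun_residual_inj (cr) => //; last exact: local_heun_coef_residual.
by case: dH => ->.
Qed.

End Heun.

(** * Convergence of series of complex numbers *)

Section ComplexField.
Variable R : realType.
Local Notation C := (complex_field R).
Local Open Scope complex_scope.

Lemma Re_norm_le (z : C) (m : R) : `|z| <= m%:C -> `|complex.Re z| <= m.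
Proof.
rewrite normc_def lecR => zm; apply: le_trans zm.
by rewrite -sqrtr_sqr ler_wsqrtr// lerDl sqr_ge0.
Qed.

Lemma Im_norm_le (z : C) (m : R) : `|z| <= m%:C -> `|complex.Im z| <= m.
Proof.
rewrite normc_def lecR => zm; apply: le_trans zm.
by rewrite -sqrtr_sqr ler_wsqrtr// lerDr sqr_ge0.
Qed.

Lemma cvgn_complex (x y : nat -> R) (l l' : R) :
  x @ \oo --> l -> y @ \oo --> l' ->
  (fun n => x n +i* y n : C) @ \oo --> (l +i* l' : C).
Proof.
move=> xl yl; apply/cvgrPdist_le => e e0.
have [r er] : exists r, e = r%:C by apply/complex_realP; exact: gtr0_real.
have r0 : 0 < r by move: e0; rewrite er ltcR.
have r2 : 0 < r / 2 by rewrite divr_gt0.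
near=> n.
have xn : `|l - x n| <= r / 2 by near: n; move/cvgrPdist_le : xl; exact.
have yn : `|l' - y n| <= r / 2 by near: n; move/cvgrPdist_le : yl; exact.
rewrite er normc_def lecR /=.
apply: le_trans (_ : `|l - x n| + `|l' - y n| <= _); last first.
  by rewrite [leRHS](splitr r) lerD.
rewrite -[leRHS]ger0_norm ?addr_ge0// -sqrtr_sqr ler_wsqrtr//.
by rewrite [leRHS]sqrrD !real_normK ?num_real// addrAC lerDl mulrn_wge0 ?mulr_ge0.
Unshelve. all: by end_near. Qed.

Lemma half_complete_complex : half_complete C.
Proof.
move=> u M uM.
have [m Mm] : exists m, M = m%:C.
  apply/complex_realP/ger0_real.
  by move: (uM 0%N); rewrite expr0 mulr1; apply: le_trans.
have bnd k : `|u k| <= (m * 2^-1 ^+ k)%:C.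
  by apply: le_trans (uM k) _; rewrite Mm rmorphM rmorphXn fmorphV rmorph_nat.
have dom (f : nat -> R) : (forall k, `|f k| <= m * 2^-1 ^+ k) -> cvgn (series f).
  move=> fm; apply: normed_cvg; apply: (series_le_cvg _ _ fm) => //.
    by move=> k; apply: le_trans (fm k).
  by apply: is_cvg_geometric_series; rewrite ger0_norm ?invf_lt1 ?ltr1n.
have /cvg_ex[l xl] := dom (fun k => complex.Re (u k)) (fun k => Re_norm_le (bnd k)).
have /cvg_ex[l' yl] := dom (fun k => complex.Im (u k)) (fun k => Im_norm_le (bnd k)).
apply/cvg_ex; exists (l +i* l').
suff -> : series u = (fun n => series (fun k => complex.Re (u k)) n
                        +i* series (fun k => complex.Im (u k)) n : C).
  exact: cvgn_complex.
apply/funext; elim => [|n IH]; first by rewrite !seriesEnat/= !big_geq.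
by rewrite !seriesSr IH; case: (u n).
Qed.

End ComplexField.

(** * Tridiagonal determinants *)

Section Tridiagonal.
Variables (F : fieldType) (d up lo : nat -> F).

(** The last row has two nonzero entries, [lo k.+1] and [d k.+2]; the minor of the
    former has [up k.+1] as the only nonzero entry of its last column. *)
Lemma det_tridiag_mxSS k : \det (tridiag_mx d up lo k.+2) =
  d k.+2 * \det (tridiag_mx d up lo k.+1)
  - up k.+1 * lo k.+1 * \det (tridiag_mx d up lo k).
Proof.
rewrite (expand_det_row _ ord_max) !big_ord_recr /= big1 ?add0r; last first.
  move=> i _; have ik := ltn_ord i; rewrite mxE /=.
  by rewrite ifF ?ifF ?ifF ?mul0r//; apply/negbTE; lia.
rewrite [RHS]addrC; congr (_ + _); last first.
  rewrite mxE /= eqxx /cofactor /= -signr_odd oddD addbb expr0 mul1r.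
  by congr (_ * \det _); apply/matrixP => i j; rewrite !mxE !lift_max.
rewrite mxE /= ltn_eqF// [k == _]ltn_eqF// eqxx.
rewrite /cofactor /= addSn exprS -signr_odd oddD addbb expr0 mulr1 mulN1r mulrN.
(* The minor of [lo k.+1], expanded along its last column. *)
rewrite [up _ * _]mulrC -mulrA; congr (- (_ * _)).
rewrite (expand_det_col _ ord_max) big_ord_recr /= big1 ?add0r; last first.
  move=> i _; have ik := ltn_ord i; rewrite !mxE !lift_max /=.
  by rewrite /bump ifF ?ifF ?ifF ?mul0r//; apply/negbTE; lia.
rewrite !mxE !lift_max /= /bump leqnn add1n gtn_eqF// eqxx.
rewrite /cofactor /= -signr_odd oddD addbb expr0 mul1r.
congr (_ * \det _); apply/matrixP => i j; rewrite !mxE !lift_max.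
have -> // : lift (widen_ord (leqnSn k.+1) ord_max) (lift ord_max j) = j :> nat.
by have jk := ltn_ord j; rewrite /= /bump; lia.
Qed.

End Tridiagonal.

(** * The two coefficient sequences *)

Section Coefficients.
Variables (K : numFieldType) (s y : K).

Lemma P_polySS k : P_poly k.+2 s y =
  (y - 4 * (k.+2%:R - 1)) * s * P_poly k.+1 s y
  + a_coef k.+1%:R * a_coef ((y - 2 * k.+1%:R + 2) / 2) * P_poly k s y.
Proof. by rewrite /P_poly det_tridiag_mxSS mulrN mulNr opprK. Qed.

Lemma Q_polySS k : Q_poly k.+2 s y =
  (y - 2 - 4 * (k.+2%:R - 1)) * s * Q_poly k.+1 s y
  + b_coef k.+1%:R * b_coef ((y - 2 * k.+1%:R) / 2) * Q_poly k s y.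
Proof. by rewrite /Q_poly det_tridiag_mxSS mulrN mulNr opprK. Qed.

Definition u_coef k : K := P_poly k s y / ((2 * k)`!)%:R.
Definition v_coef k : K := Q_poly k s y / ((2 * k + 1)`!)%:R.

Lemma u_coef0 : u_coef 0 = 1.
Proof. by rewrite /u_coef /P_poly det_mx00 muln0 fact0 divr1. Qed.

Lemma v_coef0 : v_coef 0 = 1.
Proof. by rewrite /v_coef /Q_poly det_mx00 muln0 divr1. Qed.

(** With [a = -1], [al = - y / 2], [be = - (y - 1) / 2], [ga = 1 / 2] and the given
    [de], one has [ep - de = s] and [1 + a = 0]; times [-4] the recurrence reads
      [(2 k + 2) (2 k + 1) c_(k+1)
         = (y - 4 k) s c_k + (y - 2 k + 2) (y - 2 k + 1) c_(k-1)],
    which is the recurrence of the determinants divided by [(2 k)!]. *)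
Lemma u_coef_residual k :
  heun_residual (-1) (- (y * s / 4)) (- (y / 2)) (- ((y - 1) / 2)) (1 / 2)
    ((1 - y - s) / 2) u_coef k = 0.
Proof.
rewrite /heun_residual /u_coef; case: k => [|k] /=.
  rewrite /P_poly det_mx00 det_mx11 mxE /= muln0 muln1 !factS fact0 !natrM.
  by field.
rewrite P_polySS /a_coef !mulnS !addSn !add0n !factS !natrM.
set p := P_poly k s y; set p' := P_poly k.+1 s y.
have f0 : ((2 * k)`!)%:R != 0 :> K by rewrite pnatr_eq0 -lt0n fact_gt0.
set f := ((2 * k)`!)%:R in f0 *.
have n0 m : m.+1%:R + 2 * k%:R != 0 :> K.
  by rewrite -natrM -natrD pnatr_eq0.
by field; apply/and5P; split.
Qed.

(** Likewise with
      [(2 k + 3) (2 k + 2) c_(k+1)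
         = (y - 2 - 4 k) s c_k + (y - 2 k) (y - 2 k + 1) c_(k-1)]. *)
Lemma v_coef_residual k :
  heun_residual (-1) (- ((y - 2) * s / 4)) (- ((y - 1) / 2)) (- ((y - 2) / 2))
    (3 / 2) ((1 - y - s) / 2) v_coef k = 0.
Proof.
rewrite /heun_residual /v_coef; case: k => [|k] /=.
  rewrite /Q_poly det_mx00 det_mx11 mxE /= muln0 muln1 !factS fact0 !natrM.
  by field.
rewrite Q_polySS /b_coef !mulnS !addSn !add0n !factS !natrM.
set p := Q_poly k s y; set p' := Q_poly k.+1 s y.
have f0 : ((2 * k + 1)`!)%:R != 0 :> K by rewrite pnatr_eq0 -lt0n fact_gt0.
set f := ((2 * k + 1)`!)%:R in f0 *.
have n0 m : m.+1%:R + (2 * k%:R + 1) != 0 :> K.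
  by rewrite -natrM natr1 -natrD pnatr_eq0.
by field; apply/and5P; split.
Qed.

End Coefficients.

(** * The expansions *)

Lemma near0_sqr (K : numFieldType) (Q : K -> Prop) :
  (\forall z \near (0 : K), Q z) -> \forall t \near (0 : K), Q (t ^+ 2).
Proof.
move=> Q0; have : (fun t : K => t ^+ 2) @ (0 : K) --> (0 : K).
  rewrite -[X in _ --> X](mulr0 (0 : K)).
  by apply: (@cvgM K K (nbhs (0 : K))); exact: cvg_id.
exact.
Qed.

Lemma half_integer_growth (K : numFieldType) (m k : nat) :
  k.+1%:R <= 2 * `|k%:R + m.+1%:R / 2| :> K.
Proof.
rewrite ger0_norm ?addr_ge0 ?divr_ge0// mulrDr [2 * (_ / 2)]mulrC.
by rewrite divfK ?pnatr_eq0// -natrM -natrD ler_nat; lia.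
Qed.

Unset Implicit Arguments.

Theorem proposition7p16 (R : realType) (s : complex_field R) (n : nat) :
  (\forall t \near (0 : complex_field R),
     [series P_poly k s n%:R * (t ^+ (2 * k) / ((2 * k)`!)%:R)]_k @ \oo
       --> u_fun s n t) /\
  (\forall t \near (0 : complex_field R),
     [series Q_poly k s n%:R * (t ^+ (2 * k + 1) / ((2 * k + 1)`!)%:R)]_k @ \oo
       --> v_fun s n t).
Proof.
have Kc := @half_complete_complex R.
have N10 : -1 != 0 :> complex_field R by rewrite oppr_eq0 oner_eq0.
split.
- have [HlE cv] := Hl_cpsum Kc N10 (half_integer_growth _ 0) (u_coef0 s n%:R)
                     (u_coef_residual s n%:R).
  apply: filterS (near0_sqr cv) => t ct; rewrite /u_fun HlE.
  suff -> : [series P_poly k s n%:R * (t ^+ (2 * k) / ((2 * k)`!)%:R)]_k =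
      cpseries (u_coef s n%:R) (t ^+ 2) by exact: ct.
  congr series; apply/funext => k /=.
  by rewrite /u_coef exprM mulrA mulrAC.
- have [HlE cv] := Hl_cpsum Kc N10 (half_integer_growth _ 2) (v_coef0 s n%:R)
                     (v_coef_residual s n%:R).
  apply: filterS (near0_sqr cv) => t ct; rewrite /v_fun HlE.
  suff -> : [series Q_poly k s n%:R * (t ^+ (2 * k + 1) / ((2 * k + 1)`!)%:R)]_k =
      t *: cpseries (v_coef s n%:R) (t ^+ 2) by apply: cvgZr; exact: ct.
  rewrite /cpseries -seriesZ; congr series; apply/funext => k /=.
  rewrite -[RHS]/(t * (v_coef s n%:R k * t ^+ 2 ^+ k)) /v_coef -exprM addn1.
  by rewrite exprS; ring.
Qed.
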